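(* $\mathrm{PL}\subsetneq\mathrm{ST}$.
   Context: A random-access Turing machine (RATM) is a Turing machine with $k\ge 2$ ordinary tapes (a read-only input tape, an output tape and work tapes), each equipped with its own write-only binary index tape; in each step it reads the symbols under the ordinary heads, writes on the writable ordinary tapes and on the index tapes, moves all heads, and changes state; when it enters a special random-access state $q_a$, the heads of all ordinary tapes jump (in that step) to the cells whose addresses are written in binary on the respective index tapes. Running time is the number of steps; $n$ is the input length. $\mathrm{PL}$ is the class of decision problems solvable by a RATM in polylogarithmic time, i.e. in time $O(\log^i n)$ for some $i\ge1$. $\mathrm{ST}$ is the class of decision problems solvable by a RATM in time $o(n)$. *)

(* Defs.v *)
From HB Require Import structures.
From mathcomp Require Import all_boot all_order all_algebra.
From mathcomp Require Import all_classical all_reals all_analysis.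

Set Implicit Arguments.
Unset Strict Implicit.
Unset Printing Implicit Defensive.

Import Order.TTheory GRing.Theory Num.Theory.
Import numFieldNormedType.Exports.

Local Open Scope classical_set_scope.
Local Open Scope ring_scope.

Inductive direction := Left | Stay | Right.

(* Tapes are one-way infinite with cells 0, 1, 2, ...; a left move from cell 0
   leaves the head in place. *)
Definition shift (d : direction) (p : nat) : nat :=
  match d with Left => p.-1 | Stay => p | Right => p.+1 end.

(* The k = w + 2 ordinary tapes are indexed by 'I_w.+2: tape 0 is the read-only
   input tape, tape 1 the output tape, and the other w are work tapes. *)
Record action (Q G : Type) (w : nat) := Action {
  next_state : Q;
  written : 'I_w.+1 -> G; (* written j goes to ordinary tape j + 1 *)
  index_written : 'I_w.+2 -> option bool;
  moves : 'I_w.+2 -> direction;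
  index_moves : 'I_w.+2 -> direction
}.

(* Index tapes use the alphabet {0, 1, blank}, i.e. option bool with None as
   the blank; as they are write-only, delta does not read them. *)
Record ratm (S : finType) := RATM {
  state : finType;
  symbol : finType;
  nwork : nat;
  blank : symbol;
  incl : S -> symbol;
  incl_inj : injective incl;
  incl_blank : forall a, incl a != blank;
  start : state;
  accept : state;
  reject : state;
  access : state;
  accept_reject : accept != reject;
  delta : state -> {ffun 'I_nwork.+2 -> symbol} -> action state symbol nwork
}.

(* The contents of a tape are a finite sequence, blank beyond its end. *)
Record config (S : finType) (M : ratm S) := Config {
  cur : state M;
  tape : 'I_(nwork M).+2 -> seq (symbol M);
  head : 'I_(nwork M).+2 -> nat;
  index_tape : 'I_(nwork M).+2 -> seq (option bool);
  index_head : 'I_(nwork M).+2 -> nat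
}.

Fixpoint address_from (acc : nat) (s : seq (option bool)) : nat :=
  if s is Some b :: s' then address_from (b + acc.*2)%N s' else acc.

(* The word on the index tape runs from cell 0 to the first blank, most
   significant bit first; the empty word denotes cell 0. *)
Definition address (s : seq (option bool)) : nat := address_from 0 s.

Definition init (S : finType) (M : ratm S) (x : seq S) : config M :=
  {| cur := start M;
     tape := fun i => if i == ord0 then map (@incl S M) x else [::];
     head := fun=> 0%N;
     index_tape := fun=> [::];
     index_head := fun=> 0%N |}.

Definition halted (S : finType) (M : ratm S) (c : config M) : bool :=
  (cur c == accept M) || (cur c == reject M).

Definition move_step (S : finType) (M : ratm S) (c : config M) : config M :=
  let a := delta (cur c) [ffun i => nth (blank M) (tape c i) (head c i)] in
  let itp i := set_nth None (index_tape c i) (index_head c i)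
                 (index_written a i) in
  {| cur := next_state a;
     tape := fun i =>
       if unlift ord0 i is Some j
       then set_nth (blank M) (tape c i) (head c i) (written a j)
       else tape c i;
     head := fun i =>
       if next_state a == access M then address (itp i)
       else shift (moves a i) (head c i);
     index_tape := itp;
     index_head := fun i => shift (index_moves a i) (index_head c i) |}.

Definition step (S : finType) (M : ratm S) (c : config M) : config M :=
  if halted c then c else move_step c.

Definition run (S : finType) (M : ratm S) (x : seq S) (t : nat) : config M :=
  iter t (@step S M) (init M x).

Record decision_problem := DecisionProblem {
  alphabet : finType;
  yes_instances : set (seq alphabet)
}.

Definition solves_in_time (P : decision_problem) (M : ratm (alphabet P))
    (T : nat -> nat) : Prop :=
  forall x : seq (alphabet P), exists t : nat,
    [/\ (t <= T (size x))%N,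
        yes_instances x -> cur (run M x t) = accept M
      & ~ yes_instances x -> cur (run M x t) = reject M].

Definition solvable_in_time (P : decision_problem) (T : nat -> nat) : Prop :=
  exists M : ratm (alphabet P), solves_in_time M T.

Definition PL (R : realType) (P : decision_problem) : Prop :=
  exists (T : nat -> nat) (i : nat),
    [/\ solvable_in_time P T, (1 <= i)%N
      & (fun n => (T n)%:R : R) =O_\oo (fun n => ln (n%:R : R) ^+ i)].

Definition ST (R : realType) (P : decision_problem) : Prop :=
  exists T : nat -> nat,
    solvable_in_time P T
    /\ (fun n => (T n)%:R : R) =o_\oo (fun n => n%:R : R).

(* Main.v *)
(* The inclusion holds because ln(n)^k = o(sqrt n) for every k.  It is strict
   because of the language of bit strings that carry a 1 at every position of
   the blocks [4^i, 4^i + 2^i).  A machine decides it in time O(sqrt n): in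
   phase i it jumps to cell 4^i and scans 2^i cells, and it obtains both
   addresses by appending zeros to its index tapes, so that no arithmetic is
   needed.  Conversely, a machine that runs for fewer than 2^i steps on the
   all-ones string of length 4^(i+1) misses a cell of block i; changing that
   cell to 0 does not change the run, but it changes the answer. *)

From HB Require Import structures.
From mathcomp Require Import all_boot all_order all_algebra.
From mathcomp Require Import all_classical all_reals all_analysis.
From mathcomp Require Import zify.
Require Import Defs.

Set Implicit Arguments.
Unset Strict Implicit.
Unset Printing Implicit Defensive.

Import Order.TTheory GRing.Theory Num.Theory.
Import numFieldNormedType.Exports.

(** * Polylogarithms against the square root *)

Section Growth.
Local Open Scope classical_set_scope.
Local Open Scope ring_scope.
Variable R : realType.
Implicit Types (k n : nat) (T : nat -> nat) (e : R).

Lemma expR_half_ln (x : R) : 0 < x -> expR (ln x / 2) = Num.sqrt x.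
Proof.
move=> x0; rewrite -{2}[x]lnK ?posrE// [ln x in RHS](_ : _ = 2%:R * (ln x / 2)).
  by rewrite expRM_natl sqrtr_sqr ger0_norm ?expR_ge0.
by rewrite mulrC mulfVK.
Qed.

(** The value of [expR] at [ln x / 2] is the square root of [x], and it dominates each single term
    of its Taylor series. *)
Lemma ln_exprS_le_sqrt k (x : R) : 1 <= x ->
  ln x ^+ k.+1 <= 2 ^+ k.+1 * k.+1`!%:R * Num.sqrt x.
Proof.
move=> x1; have l0 : 0 <= ln x / 2 by rewrite divr_ge0 ?ln_ge0.
have := expR_ge1Dxn k l0; rewrite expR_half_ln ?(lt_le_trans ltr01)// => le.
have f0 : 0 < k.+1`!%:R :> R by rewrite ltr0n fact_gt0.
have : (ln x / 2) ^+ k.+1 / k.+1`!%:R <= Num.sqrt x.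
  by apply: le_trans le; rewrite lerDr.
rewrite ler_pdivrMr// expr_div_n ler_pdivrMr ?exprn_gt0//.
by rewrite mulrC (mulrC (Num.sqrt x)) mulrA.
Qed.

Lemma ln_expr_le_sqrt_near k e : 0 < e ->
  \forall n \near \oo, ln (n%:R : R) ^+ k <= e * Num.sqrt n%:R.
Proof.
move=> e0; pose C : R := 2 ^+ k.+1 * k.+1`!%:R.
have C0 : 0 < C by rewrite mulr_gt0 ?exprn_gt0// ltr0n fact_gt0.
near=> n.
(* From this threshold on [ln n] is at least [C / e]; the bound for exponent [k.+1] has one factor
   [ln n] to spare, which absorbs the constant. *)
have nC : expR (C / e) <= n%:R by near: n; exact: nbhs_infty_ger.
have n1 : 1 <= n%:R :> R.
  by apply: le_trans nC; rewrite ltW// expR_gt1 divr_gt0.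
have lnC : C / e <= ln n%:R.
  by rewrite -ler_expR lnK// posrE (lt_le_trans ltr01).
have le : C / e * ln n%:R ^+ k <= C * Num.sqrt n%:R.
  apply: le_trans (ln_exprS_le_sqrt k n1).
  by rewrite exprS ler_wpM2r// exprn_ge0// ln_ge0.
rewrite -(ler_pM2l C0) mulrCA -ler_pdivrMl//.
by move: le; rewrite mulrAC mulrC.
Unshelve. all: by end_near. Qed.

Lemma polylog_le_sqrt_near T k e : 0 < e ->
  (fun n => (T n)%:R : R) =O_\oo (fun n => ln (n%:R : R) ^+ k) ->
  \forall n \near \oo, (T n)%:R <= e * Num.sqrt (n%:R : R).
Proof.
move=> e0 /eqO_exP[K K0 TK]; near=> n.
have n1 : 1 <= n%:R :> R by near: n; exact: nbhs_infty_ger.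
have : `|(T n)%:R : R| <= K * `|ln (n%:R : R) ^+ k| by near: n.
rewrite normr_nat ger0_norm ?exprn_ge0 ?ln_ge0// => /le_trans; apply.
rewrite -ler_pdivlMl// mulrA; near: n.
by apply: ln_expr_le_sqrt_near; rewrite mulr_gt0// invr_gt0.
Unshelve. all: by end_near. Qed.

Lemma littleo_of_le_sqrt T (C : R) :
  (\forall n \near \oo, (T n)%:R <= C * Num.sqrt (n%:R : R)) ->
  (fun n => (T n)%:R : R) =o_\oo (fun n => n%:R : R).
Proof.
move=> TC; apply/eqoP => e e0; near=> n.
have n1 : 1 <= n%:R :> R by near: n; exact: nbhs_infty_ger.
(* Chosen so that [C / e] is at most the square root of [n]. *)
have nC : (C / e) ^+ 2 <= n%:R by near: n; exact: nbhs_infty_ger.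
rewrite !normr_nat; apply: (@le_trans _ _ (C * Num.sqrt n%:R)); first by near: n.
rewrite -[X in _ <= e * X]sqr_sqrtr// expr2 mulrA ler_wpM2r ?sqrtr_ge0//.
rewrite -ler_pdivrMl// mulrC (le_trans (ler_norm _))//.
by rewrite -sqrtr_sqr ler_wsqrtr.
Unshelve. all: by end_near. Qed.

End Growth.

(** Index words are tracked only cell by cell, since writing a blank may lengthen the sequence;
    trailing blanks do not affect the address. *)
Lemma address_from_eq acc (s s' : seq (option bool)) :
  (forall p, nth None s p = nth None s' p) ->
  address_from acc s = address_from acc s'.
Proof.
elim: s s' acc => [|[b|] s IH] [|[b'|] s'] acc //= E; try by have := E 0.
have [->] := E 0; apply: IH => p; exact: (E p.+1).
Qed.

(** * Runs that do not see a changed input cell *)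

Section Adversary.
Variables (S : finType) (M : ratm S).
Implicit Types (c : config M) (x y : seq S).

Lemma run_halted x t u :
  halted (run M x t) -> t <= u -> run M x u = run M x t.
Proof.
move=> ht /subnK <-; elim: (u - t) => // d IH.
by rewrite addSn /run iterS -/(run M x (d + t)) IH /step ht.
Qed.

Lemma accept_not_reject x t u :
  cur (run M x t) = accept M -> cur (run M x u) = reject M -> False.
Proof.
move=> At Ru; have /eqP := accept_reject M; apply.
have hA : halted (run M x t) by rewrite /halted At eqxx.
have hR : halted (run M x u) by rewrite /halted Ru eqxx orbT.
rewrite -At -Ru; have [tu|/ltnW ut] := leqP t u.
  by rewrite (run_halted hA tu).
by rewrite (run_halted hR ut).
Qed.

(* Equality of configurations up to the contents of the input tape. *)
Record agree c c' : Prop := Agree {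
  agree_cur : cur c = cur c';
  agree_tape : forall j, tape c (lift ord0 j) = tape c' (lift ord0 j);
  agree_head : forall i, head c i = head c' i;
  agree_index_tape : forall i, index_tape c i = index_tape c' i;
  agree_index_head : forall i, index_head c i = index_head c' i
}.

(** The input tape enters a step only through the symbol under its head, and jumps depend only on
    the index tapes. *)
Lemma agree_step c c' : agree c c' ->
  nth (blank M) (tape c ord0) (head c ord0) =
    nth (blank M) (tape c' ord0) (head c ord0) ->
  agree (step c) (step c').
Proof.
move=> cc' E; have [Ec Et Eh Ei Ej] := cc'.
rewrite /step /halted -Ec; case: ifP => // _; rewrite /move_step -Ec.
have -> : [ffun i => nth (blank M) (tape c i) (head c i)] =
          [ffun i => nth (blank M) (tape c' i) (head c' i)].
  apply/ffunP => i; rewrite !ffunE -Eh.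
  by case: (unliftP ord0 i) => [j|] ->; rewrite ?Et.
by split=> //= [j|i|i|i]; rewrite ?liftK -?Et -?Eh -?Ei -?Ej.
Qed.

Lemma run_input_tape x t : tape (run M x t) ord0 = map (@incl S M) x.
Proof.
elim: t => [|t IH]; first by [].
by rewrite /run iterS -/(run M x t) /step; case: ifP => //= _; rewrite unlift_none.
Qed.

(** Only head positions of the run on [x] are examined: by induction the run on [y] has the same
    ones. *)
Lemma run_agree x y t :
  (forall s, s < t -> let p := head (run M x s) ord0 in
     nth (blank M) (map (@incl S M) x) p = nth (blank M) (map (@incl S M) y) p) ->
  agree (run M x t) (run M y t).
Proof.
elim: t => [|t IH] E.
  by split=> //= j; rewrite ?(negPf (neq_lift _ _)) // eq_sym (negPf (neq_lift _ _)).
rewrite /run !iterS -/(run M x t) -/(run M y t); apply: agree_step.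
  by apply: IH => s st; apply: E; exact: ltnW.
by rewrite !run_input_tape; exact: E.
Qed.

(** Pigeonhole: [t] head positions cannot cover [d] consecutive cells. *)
Lemma unread_cell x t a d : t < d -> exists p,
  a <= p < a + d /\ forall s, s < t -> head (run M x s) ord0 != p.
Proof.
move=> td; pose V := [seq head (run M x s) ord0 | s <- iota 0 t].
have /allPn[p pI pV] : ~~ all (mem V) (iota a d).
  apply/negP => /allP sub.
  have := uniq_leq_size (iota_uniq a d) sub.
  by rewrite size_map !size_iota leqNgt td.
exists p; split; first by rewrite -mem_iota.
move=> s st; apply: contra pV => /eqP <-; apply: map_f.
by rewrite mem_iota add0n.
Qed.

End Adversary.

(** * The language and its lower bound *)

(* Phase [i] of the machine below reads the cells [4^i, ..., 4^i + 2^i - 1];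
   cells beyond the end of the input count as [true]. *)
Definition block_ok (x : seq bool) (h k : nat) : Prop :=
  forall p, h <= p < h + k -> nth true x p.

Lemma block_ok_beyond x h k : size x <= h -> block_ok x h k.
Proof. by move=> xh p /andP[hp _]; rewrite nth_default// (leq_trans xh). Qed.

Definition sparse_ones : decision_problem :=
  @DecisionProblem bool (fun x => forall i, block_ok x (4 ^ i) (2 ^ i)).

Lemma sparse_ones_lower_bound (T : nat -> nat) i :
  solvable_in_time sparse_ones T -> 2 ^ i <= T (4 ^ i.+1).
Proof.
case=> M MT; rewrite leqNgt; apply/negP => Ti.
pose n := 4 ^ i.+1; pose x := nseq n true.
have xyes : yes_instances (d := sparse_ones) x.
  by move=> j p _; rewrite nth_nseq if_same.
have [t [tT /(_ xyes) Ax _]] := MT x; rewrite size_nseq in tT.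
have [p [pI pV]] := @unread_cell _ M x t (4 ^ i) (2 ^ i) (leq_ltn_trans tT Ti).
(* Since [4 ^ i + 2 ^ i <= 4 ^ i.+1], the missed cell lies inside the input, so changing it keeps
   the length. *)
have pn : p < n.
  have /andP[_ /leq_trans] := pI; apply.
  have : 2 ^ i <= 4 ^ i by case: (i) => [|j] //; rewrite leq_exp2r.
  by rewrite /n expnS; lia.
pose y := set_nth true x p false.
have sy : size y = n by rewrite size_set_nth size_nseq; apply/maxn_idPr.
have yno : ~ yes_instances (d := sparse_ones) y.
  by move=> /(_ i p pI); rewrite nth_set_nth /= eqxx.
have [u [_ _ /(_ yno) Ru]] := MT y.
(* By agreement the run on [y] accepts at time [t], which contradicts its rejection at time [u]. *)
apply: (accept_not_reject _ Ru); rewrite -Ax; symmetry; apply: agree_cur.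
apply: run_agree => s st /=; have hp := pV s st.
set q := head _ _ in hp *.
have [qn|nq] := ltnP q n; last by rewrite !nth_default ?size_map ?sy ?size_nseq.
rewrite !(nth_map true) ?sy ?size_nseq// nth_set_nth /=.
by rewrite (negPf hp).
Qed.

(** * A machine for the language *)

Inductive scanner_state := Start | Access | Scan | Extend | Accept | Reject.

(** A bijection with the six elements of [bool * option bool], from which the finite type structure
    is transferred. *)
Definition scanner_state_code q :=
  match q with
  | Start => (false, Some false) | Access => (false, Some true)
  | Scan => (false, None) | Extend => (true, Some false)
  | Accept => (true, Some true) | Reject => (true, None)
  end.

Definition scanner_state_decode (u : bool * option bool) :=
  match u with
  | (false, Some false) => Start | (false, Some true) => Access
  | (false, None) => Scan | (true, Some false) => Extend
  | (true, Some true) => Accept | (true, None) => Reject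
  end.

Lemma scanner_state_codeK : cancel scanner_state_code scanner_state_decode.
Proof. by case. Qed.

HB.instance Definition _ := Finite.copy scanner_state (can_type scanner_state_codeK).

(* Writes [m] on the output tape; [zi] and [zo] tell whether a zero is appended
   to the word on the index tape of the input tape and of the output tape. *)
Definition scanner_action q m (zi zo : bool) (di do : direction) :
    action scanner_state (option bool) 0 :=
  let z (i : 'I_2) := if i == ord0 then zi else zo in
  {| next_state := q;
     written := fun=> m;
     index_written := fun i => if z i then Some false else None;
     moves := fun i => if i == ord0 then di else do;
     index_moves := fun i => if z i then Right else Stay |}.

(* Cell 0 of the output tape carries the only nonblank symbol [m] of that tape,
   so that the output head, moving left, counts down to 0. *)
Definition scanner_delta q (s m : option bool) :
    action scanner_state (option bool) 0 :=
  match q with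
  | Start =>
    {| next_state := Access;
       written := fun=> Some true;
       index_written := fun=> Some true;
       moves := fun=> Stay;
       index_moves := fun=> Right |}
  | Extend => scanner_action Access m true false Stay Stay
  | _ =>
    match s, m with
    | None, _ => scanner_action Accept m false false Stay Stay
    | _, Some _ => scanner_action Extend m true true Stay Stay
    | Some true, None => scanner_action Scan m false false Right Left
    | Some false, None => scanner_action Reject m false false Stay Stay
    end
  end.

Lemma Some_neq_None (a : bool) : Some a != None. Proof. by []. Qed.

Definition scanner : ratm bool :=
  @RATM bool scanner_state (option bool) 0 None Some (@Some_inj _)
    Some_neq_None Start Accept Reject Access isT
    (fun q r => scanner_delta q (r ord0) (r (lift ord0 ord0))).

(** * Invariant, correctness and running time of the machine *)

Definition power_word (a : nat) : seq (option bool) :=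
  Some true :: nseq a (Some false).

Lemma address_power_word a : address (power_word a) = 2 ^ a.
Proof.
have zeros m : address_from m (nseq a (Some false)) = m * 2 ^ a.
  elim: a m => [|a IH] m; first by rewrite muln1.
  by rewrite /= add0n IH expnS -muln2 mulnA.
by rewrite /address /= zeros mul1n.
Qed.

Lemma nth_power_word a p :
  nth None (power_word a) p =
  if p == 0 then Some true else if p <= a then Some false else None.
Proof. by case: p => [|p] //=; rewrite nth_nseq. Qed.

Definition marker (k : nat) : option bool := if k == 0 then Some true else None.

(* In state [q] the heads are at [h] on the input [x] and at [k] on the output
   tape, and the index tapes hold the numbers [2^a] and [2^b]. *)
Record scanner_at (x : seq bool) q (h k a b : nat) (c : config scanner) : Prop :=
  ScannerAt {
    at_cur : cur c = q;
    at_input : tape c ord0 = map Some x;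
    at_output : forall p, nth None (tape c (lift ord0 ord0)) p = marker p;
    at_head0 : head c ord0 = h;
    at_head1 : head c (lift ord0 ord0) = k;
    at_index0 : forall p, nth None (index_tape c ord0) p = nth None (power_word a) p;
    at_index1 : forall p,
      nth None (index_tape c (lift ord0 ord0)) p = nth None (power_word b) p;
    at_index_head0 : index_head c ord0 = a.+1;
    at_index_head1 : index_head c (lift ord0 ord0) = b.+1
  }.

(** The index head stands on the first blank after the word: a zero written there doubles the
    number, a blank changes no cell. *)
Lemma power_word_append (s : seq (option bool)) a (z : bool) :
  (forall p, nth None s p = nth None (power_word a) p) ->
  forall p, nth None (set_nth None s a.+1 (if z then Some false else None)) p =
            nth None (power_word (a + z)) p.
Proof.
move=> E p; rewrite nth_set_nth /= E !nth_power_word.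
case: z; rewrite ?addn1 ?addn0; case: p => [|p] //=; rewrite eqSS.
- by rewrite [p < a.+1]leq_eqVlt eqSS; case: eqP => //= _.
- by case: eqP => [->|//]; rewrite ltnn.
Qed.

(** Serves every transition after the first: each writes back the output symbol it read, so the
    marker stays in place. *)
Lemma scanner_at_step x q h k a b c q' zi zo di do :
  scanner_at x q h k a b c -> q != Accept -> q != Reject ->
  scanner_delta q (nth None (map Some x) h) (marker k) =
    scanner_action q' (marker k) zi zo di do ->
  scanner_at x q'
    (if q' == Access then 2 ^ (a + zi) else shift di h)
    (if q' == Access then 2 ^ (b + zo) else shift do k)
    (a + zi) (b + zo) (step c).
Proof.
move=> [Ec Et Eo Eh Ek Ei Ej El Em] qA qR Ed.
rewrite /step /halted Ec (negPf qA) (negPf qR) /=.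
have Er : delta (r := scanner) (cur c)
    [ffun i => nth (blank scanner) (tape c i) (head c i)] =
    scanner_action q' (marker k) zi zo di do.
  by rewrite /= Ec !ffunE Et Eh Ek Eo.
have Ei' := power_word_append zi Ei; have Ej' := power_word_append zo Ej.
rewrite /move_step Er; split=> /=; rewrite ?Eh ?Ek ?El ?Em ?unlift_none //.
- by move=> p; rewrite liftK nth_set_nth /= Eo; case: eqP => [->|].
- by case: ifP => // _; rewrite -(address_power_word (a + zi)); apply: address_from_eq.
- by case: ifP => // _; rewrite -(address_power_word (b + zo)); apply: address_from_eq.
- by case: (zi); rewrite /= ?addn1 ?addn0.
- by case: (zo); rewrite /= ?addn1 ?addn0.
Qed.

Lemma scanner_at_run1 x : scanner_at x Access 1 1 0 0 (run scanner x 1).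
Proof.
rewrite /run /= /step /halted /= /move_step /=.
by split=> //=; rewrite ?unlift_none // => -[|[|p]]; rewrite ?liftK.
Qed.

(** Induction on the counter [k]. [Access] and [Scan] behave alike, and both are allowed because a
    phase starts in the former and continues in the latter. *)
Lemma scanner_scan x q h k a b c :
  q = Access \/ q = Scan -> scanner_at x q h k a b c ->
  exists t, t <= k.+1 /\
  [\/ [/\ cur (iter t (@step _ scanner) c) = Accept,
          size x <= h + k & block_ok x h k],
      cur (iter t (@step _ scanner) c) = Reject /\ ~ block_ok x h k
    | [/\ t = k.+1, h + k < size x, block_ok x h k &
          scanner_at x Extend (h + k) 0 a.+1 b.+1 (iter t (@step _ scanner) c)]].
Proof.
elim: k q h c => [|k IH] q h c Hq Hc.
all: have qA : q != Accept by case: Hq => ->.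
all: have qR : q != Reject by case: Hq => ->.
all: have [hx|xh] := ltnP h (size x); last first.
1,3: have := scanner_at_step Hc qA qR; move=> /(_ Accept false false Stay Stay);
     rewrite nth_default ?size_map// => /(_ ltac:(by case: Hq => ->)) Hs;
     exists 1; split=> //; constructor 1; split; [exact: at_cur Hs|by lia|];
     exact: block_ok_beyond.
all: have := scanner_at_step Hc qA qR; rewrite (nth_map true)// => Hstep.
  have Hs := Hstep Extend true true Stay Stay
    ltac:(by case: Hq => ->; case: (nth true x h)).
  exists 1; split=> //; constructor 3; split=> //;
    [by rewrite addn0|by move=> p; lia|].
  by move: Hs; rewrite /= !addn0 !addn1.
case xh : (nth true x h) in Hstep; last first.
  have Hs := Hstep Reject false false Stay Stay ltac:(by case: Hq => ->).
  exists 1; split=> //; constructor 2; split; first exact: at_cur Hs.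
  by move=> /(_ h); rewrite xh; lia.
have := Hstep Scan false false Right Left ltac:(by case: Hq => ->).
rewrite /= !addn0 => /(IH _ _ _ (or_intror erefl))[t [tk Ht]].
have okS : block_ok x h k.+1 <-> block_ok x h.+1 k.
  split=> ok p pI; first by apply: ok; lia.
  by have [->|ph] := eqVneq p h; [rewrite xh|apply: ok; lia].
exists t.+1; split; first by [].
rewrite iterSr addnS -addSn; case: Ht => [[? ? /okS]|[? nok]|[-> ? /okS]].
- by constructor 1.
- by constructor 2; split=> // /okS.
- by constructor 3.
Qed.

(** Holds because [2 ^ i <= 4 ^ i]. It justifies accepting when the input ends by the end of block
    [i]: all later blocks lie beyond the input. *)
Lemma leq_block_next i j : i < j -> 4 ^ i + 2 ^ i <= 4 ^ j.
Proof.
move=> ij; apply: (@leq_trans (4 ^ i.+1)); last by rewrite leq_exp2l.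
have : 2 ^ i <= 4 ^ i by case: (i) => [|m] //; rewrite leq_exp2r.
by rewrite expnS; lia.
Qed.

(** Phase [j] costs at most [2 ^ j + 1] steps, plus one for [Extend] if another phase follows; the
    time bound is the geometric sum of these costs over phases [i] to [i + d]. *)
Lemma scanner_phases x i d c :
  scanner_at x Access (4 ^ i) (2 ^ i) i.*2 i c -> size x <= 4 ^ (i + d) ->
  exists t, t + 2 ^ i + i.*2 <= (2 ^ (i + d)).*2 + (i + d).*2 + 1 /\
  ((cur (iter t (@step _ scanner) c) = Accept /\
    forall j, i <= j -> block_ok x (4 ^ j) (2 ^ j)) \/
   (cur (iter t (@step _ scanner) c) = Reject /\
    ~ forall j, i <= j -> block_ok x (4 ^ j) (2 ^ j))).
Proof.
elim: d i c => [|d IH] i c Hc xd;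
  have [t [tk Ht]] := scanner_scan (or_introl erefl) Hc.
2: have le2 : 2 * 2 ^ i <= 2 ^ (i + d.+1)
     by rewrite addnS expnS leq_mul2l leq_exp2l ?leq_addr.
all: case: Ht => [[At xi ok]|[Rt nok]|[Et xi ok Ht]].
1,4: exists t; split; [by rewrite ?addn0; lia|left; split=> // j];
     rewrite leq_eqVlt => /predU1P[<-//|ij];
     by apply: block_ok_beyond; apply: leq_trans xi (leq_block_next ij).
1,3: exists t; split; [by rewrite ?addn0; lia|right; split=> // ok];
     by apply: nok; apply: ok.
  (* For [d = 0] the input ends by cell [4 ^ i], so the scan cannot pass the block. *)
  by move: xd xi; rewrite addn0; lia.
(* The scan ended by appending a zero to both index words; [Extend] appends a second one for the
   input tape, which turns [4 ^ i] into [4 ^ i.+1] and [2 ^ i] into [2 ^ i.+1]. *)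
have := scanner_at_step Ht isT isT (erefl : scanner_delta Extend _ _ = _).
rewrite /= addn0 addn1 -[i.*2.+2]/(i.+1.*2) -iterS.
rewrite -[in 2 ^ i.+1.*2]mul2n expnM -[2 ^ 2]/4.
move=> /IH; rewrite addSnnS => /(_ xd)[t' [tb Hor]].
exists (t' + t.+1); rewrite iterD; split.
  by move: tb; rewrite Et expnS; lia.
case: Hor => [[At' okS]|[Rt' nokS]]; [left|right]; split=> //.
  by move=> j; rewrite leq_eqVlt => /predU1P[<-//|]; exact: okS.
by move=> okj; apply: nokS => j /ltnW; exact: okj.
Qed.

Definition scanner_time (n : nat) : nat := 2 ^ (up_log 4 n).+2.

Lemma scanner_solves :
  @solves_in_time sparse_ones scanner scanner_time.
Proof.
move=> x; set D := up_log 4 (size x).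
have [t [tb Hor]] :=
  @scanner_phases x 0 D _ (scanner_at_run1 x) (up_logP _ (isT : 1 < 4)).
exists (t + 1); rewrite /run iterD; split.
(* The total is at most [2 * 2 ^ D + 2 * D + 1], and [D < 2 ^ D] bounds it by [4 * 2 ^ D]. *)
- have := ltn_expl D (isT : 1 < 2); move: tb.
  by rewrite /scanner_time -/D !expnS add0n; lia.
- by move=> yes; case: Hor => [[]//|[_]] [] j _; exact: yes.
- by move=> no; case: Hor => [[_ ok]|[]//]; case: no => j; exact: ok.
Qed.

(** With [D = up_log 4 n], the square is [4 ^ (D + 2) = 64 * 4 ^ (D - 1)], and [4 ^ (D - 1) < n] by
    minimality of [D] when [n > 1]. *)
Lemma scanner_time_sqr n : 0 < n -> scanner_time n ^ 2 <= 64 * n.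
Proof.
rewrite leq_eqVlt => /predU1P[<-|n1]; first by rewrite /scanner_time up_log1.
have u0 : 0 < up_log 4 n by rewrite up_log_gt0.
have lt := up_log_gtn (isT : 1 < 4) n1.
rewrite /scanner_time -expnM mulnC expnM -[2 ^ 2]/4 -(prednK u0) !expnS.
by rewrite !mulnA leq_mul2l ltnW.
Qed.

(** * Inclusion and strictness *)

Section Separation.
Local Open Scope classical_set_scope.
Local Open Scope ring_scope.
Variable R : realType.

Lemma PL_sub_ST P : PL R P -> ST R P.
Proof.
move=> [T [k [solT _ TO]]]; exists T; split=> //.
apply: (@littleo_of_le_sqrt _ _ 1); exact: polylog_le_sqrt_near TO.
Qed.

Lemma sparse_ones_ST : ST R sparse_ones.
Proof.
exists scanner_time; split; first by exists scanner; exact: scanner_solves.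
(* The constant 8 is the square root of the 64 in [scanner_time_sqr]. *)
apply: (@littleo_of_le_sqrt _ _ 8); near=> n.
have n0 : (0 < n)%N by near: n; exact: nbhs_infty_gt.
rewrite -ler_sqr ?nnegrE ?mulr_ge0 ?sqrtr_ge0// exprMn sqr_sqrtr//.
by rewrite -!natrX -natrM ler_nat; exact: scanner_time_sqr.
Unshelve. all: by end_near. Qed.

Lemma sparse_ones_not_PL : ~ PL R sparse_ones.
Proof.
move=> [T [k [solT _ TO]]].
(* At [n = 4 ^ N.+1] this factor gives [T n <= 2 ^ N.+1 / 4], strictly below the lower bound
   [2 ^ N]. *)
have h0 : 0 < 4^-1 :> R by [].
have [N _ TN] := polylog_le_sqrt_near h0 TO.
have NN : (N <= 4 ^ N.+1)%N by apply/ltnW/(leq_trans (ltnSn N))/ltnW/ltn_expl.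
have := TN _ NN; apply/negP; rewrite -ltNge.
have -> : (4 ^ N.+1)%:R = (2 ^+ N.+1) ^+ 2 :> R.
  by rewrite natrX -exprM mulnC exprM; congr (_ ^+ _); rewrite -natrX.
rewrite sqrtr_sqr ger0_norm ?exprn_ge0//.
apply: (@lt_le_trans _ _ (2 ^ N)%:R); last first.
  by rewrite ler_nat; exact: sparse_ones_lower_bound.
rewrite natrX exprS mulrA gtr_pMl ?exprn_gt0//.
by rewrite ltr_pdivrMl// mulr1 ltr_nat.
Qed.

End Separation.

Theorem theorem3 (R : realType) :
  (forall P : decision_problem, PL R P -> ST R P) /\
  (exists P : decision_problem, ST R P /\ ~ PL R P).
Proof.
split; first exact: PL_sub_ST.
by exists sparse_ones; split; [exact: sparse_ones_ST|exact: sparse_ones_not_PL].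
Qed.
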